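(* Let $M$ and $N$ be finitely generated monoids, each having only finitely many left ideals and finitely many right ideals, and suppose $M$ and $N$ are quasi-isometric. If $M$ is finitely presented with solvable word problem, then $N$ is finitely presented with solvable word problem.
   Context: For a monoid $S$ generated by a finite set $A$, $d_A(x,y)=\inf\{|w|:w\in A^*,\ xw=y\}$ ($A^*$ the free monoid on $A$, $\inf\emptyset=\infty$). A map $f:(S,d_A)\to(T,d_B)$ is a quasi-isometry if there are $1\le\lambda<\infty$, $0<\epsilon<\infty$, $0\le\mu<\infty$ with $\frac1\lambda d_A(x,y)-\epsilon\le d_B(f(x),f(y))\le\lambda d_A(x,y)+\epsilon$ for all $x,y$, and for each $t\in T$ some $x\in S$ with $\max(d_B(t,f(x)),d_B(f(x),t))\le\mu$. Monoids $S,T$ are quasi-isometric if $(S,d_A)$, $(T,d_B)$ are quasi-isometric for some finite generating sets $A,B$. ''Finitely presented with solvable word problem'' means the monoid admits a finite presentation for which the word problem is decidable. *)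

(* Defs.v *)
From Stdlib Require Import Reals List Arith.
Import ListNotations.
Open Scope R_scope.

Record monoid := Monoid {
  mcar :> Type;
  mmul : mcar -> mcar -> mcar;
  munit : mcar;
  massoc : forall x y z, mmul x (mmul y z) = mmul (mmul x y) z;
  mul1m : forall x, mmul munit x = x;
  mulm1 : forall x, mmul x munit = x }.

Definition mprod (M : monoid) (w : list M) : M := fold_right (mmul M) (munit M) w.

Definition word_over (M : monoid) (A : list M) (w : list M) : Prop :=
  Forall (fun a => In a A) w.

Definition generates (M : monoid) (A : list M) : Prop :=
  forall x : M, exists w, word_over M A w /\ mprod M w = x.

Definition finitely_generated (M : monoid) : Prop :=
  exists A : list M, generates M A.

(** [dist_le A x y r] means d_A(x,y) <= r, where
    d_A(x,y) = inf { |w| : w in A^*, x w = y } (inf of the empty set = oo).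
    Since the infimum of a nonempty set of naturals is attained,
    d_A(x,y) <= r iff some such word has length <= r. *)
Definition dist_le (M : monoid) (A : list M) (x y : M) (r : R) : Prop :=
  exists w, word_over M A w /\ mmul M x (mprod M w) = y /\ INR (length w) <= r.

(** f : (M,d_A) -> (N,d_B) is a quasi-isometry:
    (1/lam) d_A(x,y) - eps <= d_B(fx,fy) <= lam d_A(x,y) + eps  (values in [0,oo])
    and every t is within mu (in both directions) of some f x.
    The upper bound is stated as: d_A(x,y) <= r -> d_B(fx,fy) <= lam r + eps;
    the lower bound as: d_B(fx,fy) <= r -> d_A(x,y) <= lam (r + eps). *)
Definition quasi_isometry (M N : monoid) (A : list M) (B : list N) (f : M -> N) : Prop :=
  exists lam eps mu : R,
    1 <= lam /\ 0 < eps /\ 0 <= mu /\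
    (forall x y r, dist_le M A x y r -> dist_le N B (f x) (f y) (lam * r + eps)) /\
    (forall x y r, dist_le N B (f x) (f y) r -> dist_le M A x y (lam * (r + eps))) /\
    (forall t : N, exists x : M, dist_le N B t (f x) mu /\ dist_le N B (f x) t mu).

Definition quasi_isometric (M N : monoid) : Prop :=
  exists (A : list M) (B : list N) (f : M -> N),
    generates M A /\ generates N B /\ quasi_isometry M N A B f.

Definition left_ideal (M : monoid) (I : M -> Prop) : Prop :=
  forall m x : M, I x -> I (mmul M m x).
Definition right_ideal (M : monoid) (I : M -> Prop) : Prop :=
  forall m x : M, I x -> I (mmul M x m).

Definition finitely_many (M : monoid) (P : (M -> Prop) -> Prop) : Prop :=
  exists L : list (M -> Prop),
    forall I, P I -> exists J, In J L /\ forall x, I x <-> J x.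

Inductive recf : Type :=
| RZero : recf
| RSucc : recf
| RProj : nat -> recf
| RComp : recf -> list recf -> recf
| RPrec : recf -> recf -> recf
| RMin  : recf -> recf.

Inductive reval : recf -> list nat -> nat -> Prop :=
| ev_zero v : reval RZero v 0
| ev_succ x v : reval RSucc (x :: v) (S x)
| ev_proj i v : (i < length v)%nat -> reval (RProj i) v (nth i v 0%nat)
| ev_comp f gs v ws y : revals gs v ws -> reval f ws y -> reval (RComp f gs) v y
| ev_prec0 f g v y : reval f v y -> reval (RPrec f g) (0%nat :: v) y
| ev_precS f g n v z y :
    reval (RPrec f g) (n :: v) z -> reval g (n :: z :: v) y ->
    reval (RPrec f g) (S n :: v) y
| ev_min f v n :
    reval f (n :: v) 0%nat ->
    (forall m, (m < n)%nat -> exists k, reval f (m :: v) (S k)) ->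
    reval (RMin f) v n
with revals : list recf -> list nat -> list nat -> Prop :=
| evs_nil v : revals [] v []
| evs_cons g gs v y ys : reval g v y -> revals gs v ys -> revals (g :: gs) v (y :: ys).

Definition decidable_nat (P : nat -> Prop) : Prop :=
  exists f : recf, forall n,
    (P n -> reval f [n] 1%nat) /\ (~ P n -> reval f [n] 0%nat).

Definition cpair (n m : nat) : nat := ((n + m) * (n + m + 1) / 2 + m)%nat.
Fixpoint code_word (w : list nat) : nat :=
  match w with
  | [] => 0%nat
  | a :: l => S (cpair a (code_word l))
  end.

Inductive rcong (Rel : list (list nat * list nat)) : list nat -> list nat -> Prop :=
| rc_refl u : rcong Rel u u
| rc_sym u v : rcong Rel u v -> rcong Rel v u
| rc_trans u v w : rcong Rel u v -> rcong Rel v w -> rcong Rel u w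
| rc_step p l r s : In (l, r) Rel -> rcong Rel (p ++ l ++ s) (p ++ r ++ s).

Definition letters_lt (k : nat) (w : list nat) : Prop := Forall (fun i => (i < k)%nat) w.

Definition pres_eval (M : monoid) (gens : list M) (w : list nat) : M :=
  mprod M (map (fun i => nth i gens (munit M)) w).

Definition is_finite_presentation (M : monoid) (gens : list M)
    (Rel : list (list nat * list nat)) : Prop :=
  let k := length gens in
  Forall (fun lr => letters_lt k (fst lr) /\ letters_lt k (snd lr)) Rel /\
  (forall x : M, exists w, letters_lt k w /\ pres_eval M gens w = x) /\
  (forall u v, letters_lt k u -> letters_lt k v ->
     (pres_eval M gens u = pres_eval M gens v <-> rcong Rel u v)).

Definition solvable_word_problem (k : nat) (Rel : list (list nat * list nat)) : Prop :=
  decidable_nat (fun n => exists u v, letters_lt k u /\ letters_lt k v /\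
                    n = cpair (code_word u) (code_word v) /\ rcong Rel u v).

Definition fp_solvable_wp (M : monoid) : Prop :=
  exists (gens : list M) (Rel : list (list nat * list nat)),
    is_finite_presentation M gens Rel /\ solvable_word_problem (length gens) Rel.

(* Main.v *)
(** Call two paths of the Cayley graph of a monoid that start at 1 and have the same end
    homotopic if they are linked by moves replacing a subpath of bounded length by another
    one with the same ends.  A finite presentation makes all such pairs homotopic, and a
    solvable word problem bounds the number of moves by a computable function of the
    lengths: search for a derivation of every true equation of the given size.

    Such a bound passes through a quasi-isometry [f] with quasi-inverse [g]: send a pair of
    paths to [M] by [g], apply the homotopy there, come back by [f], and compare a path with
    its round trip by a ladder whose rungs are bounded paths in both directions.  The path in
    [M] starts at [g 1] instead of 1, which is harmless because [g 1] is right invertible.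

    Conversely, bounded homotopies give a finite presentation when there are finitely many
    left ideals.  The move [l -> r] is allowed at [x] when [x l = x r], which depends only on
    the L-class of [x].  If [y] runs over words for representatives of the finitely many
    L-classes, the relations [y i = q y'] ([i] a generator, [y'] the representative of the
    class of [y i]) rewrite any word of value [x] to one ending in the representative of the
    class of [x]; adding the finitely many true relations [y l = y r] with [l], [r] of bounded
    length, every move becomes a derivation of linear length.  So derivations in [N] have
    computably bounded length, and a bounded search decides the word problem. *)

From Stdlib Require Import Reals List Arith Lia Lra Classical ClassicalEpsilon.
Require Import Defs.
Import ListNotations.
Local Open Scope nat_scope.

(** * Computable functions *)

(** Total functions of the argument list are used, constrained only at arity [k], so that later
    functions are ordinary terms whose programs stay hidden. *)
Definition computable (k : nat) (F : list nat -> nat) : Prop :=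
  exists f, forall v, length v = k -> reval f v (F v).

Lemma computable_ext k F G :
  (forall v, length v = k -> F v = G v) -> computable k F -> computable k G.
Proof.
  intros E [f Hf]. exists f. intros v Hv. rewrite <- E; auto.
Qed.

Lemma computable_proj k i : i < k -> computable k (fun v => nth i v 0).
Proof.
  intros Hi. exists (RProj i). intros v Hv. constructor. lia.
Qed.

Lemma computable_succ k F : computable k F -> computable k (fun v => S (F v)).
Proof.
  intros [f Hf]. exists (RComp RSucc [f]). intros v Hv.
  econstructor; [repeat constructor; auto | constructor].
Qed.

Lemma computable_const k c : computable k (fun _ => c).
Proof.
  induction c as [|c IH].
  - exists RZero. intros. constructor.
  - apply (computable_succ k (fun _ => c) IH).
Qed.

Lemma computable_comp k F Gs :
  computable (length Gs) F -> Forall (computable k) Gs ->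
  computable k (fun v => F (map (fun G => G v) Gs)).
Proof.
  intros [f Hf] HG.
  assert (H : exists gs, forall v, length v = k -> revals gs v (map (fun G => G v) Gs)).
  { clear f Hf. induction HG as [|G Gs [g Hg] _ [gs Hgs]].
    - exists []. intros. constructor.
    - exists (g :: gs). intros. simpl. constructor; auto. }
  destruct H as [gs Hgs]. exists (RComp f gs). intros v Hv.
  econstructor; [apply Hgs; auto|]. apply Hf. now rewrite length_map.
Qed.

(** Computability shown once, on projections, extends to arbitrary computable arguments; with the
    two analogues below, it can then follow the syntax of a term. *)
Lemma computable_app1 f :
  computable 1 (fun v => f (nth 0 v 0)) ->
  forall k F, computable k F -> computable k (fun v => f (F v)).
Proof.
  intros Hf k F HF. apply (computable_comp k _ [F] Hf). auto.
Qed.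

Lemma computable_app2 f :
  computable 2 (fun v => f (nth 0 v 0) (nth 1 v 0)) ->
  forall k F G, computable k F -> computable k G -> computable k (fun v => f (F v) (G v)).
Proof.
  intros Hf k F G HF HG. apply (computable_comp k _ [F; G] Hf). auto.
Qed.

Lemma computable_app3 f :
  computable 3 (fun v => f (nth 0 v 0) (nth 1 v 0) (nth 2 v 0)) ->
  forall k F G H, computable k F -> computable k G -> computable k H ->
  computable k (fun v => f (F v) (G v) (H v)).
Proof.
  intros Hf k F G H HF HG HH. apply (computable_comp k _ [F; G; H] Hf). auto.
Qed.

Lemma map_nth_seq (v : list nat) : map (fun i => nth i v 0) (seq 0 (length v)) = v.
Proof.
  induction v as [|a v IH]; simpl; auto.
  f_equal. rewrite <- seq_shift, map_map. exact IH.
Qed.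

(** [RPrec] recurses on its first argument and passes the others on as parameters; composing it with
    [c] and the projections [ps] allows a computed number of iterations. *)
Lemma computable_rec k a s c :
  computable k a -> computable (S (S k)) s -> computable k c ->
  computable k (fun v => nat_rect (fun _ => nat) (a v) (fun n r => s (n :: r :: v)) (c v)).
Proof.
  intros [f Hf] [g Hg] Hc.
  assert (HP : computable (S k) (fun v => nat_rect (fun _ => nat) (a (tl v))
                 (fun n r => s (n :: r :: tl v)) (hd 0 v))).
  { exists (RPrec f g). intros [|n v] Hv; simpl in Hv; [lia|]. injection Hv as Hv. simpl.
    induction n as [|n IH]; simpl.
    - constructor; auto.
    - econstructor; [apply IH|]. apply Hg. simpl. lia. }
  set (ps := map (fun i (v : list nat) => nth i v 0) (seq 0 k)).
  assert (L : length (c :: ps) = S k)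
    by (simpl; unfold ps; now rewrite length_map, length_seq).
  rewrite <- L in HP. apply (computable_comp k) in HP.
  - eapply computable_ext; [|exact HP]. intros v Hv. simpl.
    replace (map (fun G => G v) ps) with v; auto.
    unfold ps. rewrite map_map. subst k. symmetry. apply map_nth_seq.
  - constructor; auto. apply Forall_forall. intros G HG. unfold ps in HG.
    apply in_map_iff in HG. destruct HG as [i [<- Hi]]. apply in_seq in Hi.
    apply computable_proj. lia.
Qed.

Lemma least_zero (F : nat -> nat) :
  (exists n, F n = 0) -> exists n, F n = 0 /\ forall m, m < n -> F m <> 0.
Proof.
  intros [n Hn]. induction n as [n IH] using lt_wf_ind.
  destruct (classic (exists m, m < n /\ F m = 0)) as [[m [Hm E]]|H]; [eauto|].
  exists n. split; auto. intros m Hm E. apply H. eauto.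
Qed.

(** Totality of [F] makes all values before the first zero evaluate to successors, as [RMin]
    demands. The least zero itself is picked by choice. *)
Lemma computable_min k F :
  computable (S k) F -> (forall v, length v = k -> exists n, F (n :: v) = 0) ->
  exists m, computable k m /\ forall v, length v = k -> F (m v :: v) = 0.
Proof.
  intros [f Hf] HF.
  assert (H : forall v, exists n, length v = k ->
            F (n :: v) = 0 /\ forall m, m < n -> F (m :: v) <> 0).
  { intros v. destruct (Nat.eq_dec (length v) k) as [E|E].
    - destruct (least_zero (fun n => F (n :: v)) (HF v E)) as [n Hn]. eauto.
    - exists 0. intros. contradiction. }
  set (m v := proj1_sig (constructive_indefinite_description _ (H v))).
  assert (Hm : forall v, length v = k ->
            F (m v :: v) = 0 /\ forall i, i < m v -> F (i :: v) <> 0).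
  { intros v. unfold m. destruct constructive_indefinite_description. auto. }
  exists m. split; [|intros; now apply Hm].
  exists (RMin f). intros v Hv. destruct (Hm v Hv) as [E Hlt]. constructor.
  - rewrite <- E. apply Hf. simpl. lia.
  - intros i Hi. specialize (Hlt i Hi). exists (pred (F (i :: v))).
    replace (S (pred (F (i :: v)))) with (F (i :: v)) by lia.
    apply Hf. simpl. lia.
Qed.

(** Tests return 0 for true, in accordance with [RMin]; since subtraction is truncated, [diff] is
    the equality test. *)
Definition ifz (c a b : nat) : nat := match c with 0 => a | S _ => b end.
Definition diff (a b : nat) : nat := (a - b) + (b - a).

Ltac computable_step :=
  first [ assumption | apply computable_const | apply computable_proj; simpl; lia
        | apply computable_succ ].

Lemma computable_ifz : forall k F G H, computable k F -> computable k G -> computable k H ->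
  computable k (fun v => ifz (F v) (G v) (H v)).
Proof.
  apply computable_app3. eapply computable_ext;
    [|apply (computable_rec 3 (fun v => nth 1 v 0) (fun v => nth 4 v 0) (fun v => nth 0 v 0));
      repeat computable_step].
  intros v _. simpl. destruct (nth 0 v 0); reflexivity.
Qed.

Lemma computable_pred : forall k F, computable k F -> computable k (fun v => pred (F v)).
Proof.
  apply computable_app1. eapply computable_ext;
    [|apply (computable_rec 1 (fun v => 0) (fun v => nth 0 v 0) (fun v => nth 0 v 0));
      repeat computable_step].
  intros v _. simpl. destruct (nth 0 v 0); reflexivity.
Qed.

Lemma computable_add : forall k F G, computable k F -> computable k G ->
  computable k (fun v => F v + G v).
Proof.
  apply computable_app2. eapply computable_ext;
    [|apply (computable_rec 2 (fun v => nth 0 v 0) (fun v => S (nth 1 v 0)) (fun v => nth 1 v 0));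
      repeat computable_step].
  intros v _. simpl. induction (nth 1 v 0); simpl; lia.
Qed.

Lemma computable_sub : forall k F G, computable k F -> computable k G ->
  computable k (fun v => F v - G v).
Proof.
  apply computable_app2. eapply computable_ext;
    [|apply (computable_rec 2 (fun v => nth 0 v 0) (fun v => pred (nth 1 v 0))
               (fun v => nth 1 v 0));
      repeat first [computable_step | apply computable_pred]].
  intros v _. simpl. induction (nth 1 v 0); simpl; lia.
Qed.

Lemma computable_mul : forall k F G, computable k F -> computable k G ->
  computable k (fun v => F v * G v).
Proof.
  apply computable_app2. eapply computable_ext;
    [|apply (computable_rec 2 (fun v => 0) (fun v => nth 1 v 0 + nth 2 v 0)
               (fun v => nth 1 v 0));
      repeat first [computable_step | apply computable_add]].
  intros v _. simpl. induction (nth 1 v 0); simpl; lia.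
Qed.

Ltac computable_arith :=
  repeat first [ computable_step | apply computable_ifz | apply computable_pred
               | apply computable_add | apply computable_sub | apply computable_mul ].

Lemma computable_diff k F G : computable k F -> computable k G ->
  computable k (fun v => diff (F v) (G v)).
Proof. intros. unfold diff. computable_arith. Qed.

(** * Pairing and words as numbers *)

Definition tri (n : nat) : nat := nat_rect (fun _ => nat) 0 (fun n r => r + S n) n.
(** The largest [d] with [tri d <= z], that is, the diagonal of [z] in the Cantor pairing; it grows
    by at most one when [z] does, hence the recursion. *)
Definition diag (z : nat) : nat :=
  nat_rect (fun _ => nat) 0 (fun z r => ifz (diff (S z) (tri (S r))) (S r) r) z.
Definition csnd (z : nat) : nat := z - tri (diag z).
Definition cfst (z : nat) : nat := diag z - csnd z.

Lemma tri_S n : tri (S n) = tri n + S n.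
Proof. reflexivity. Qed.

Lemma tri_le n m : n <= m -> tri n <= tri m.
Proof. induction 1; [auto | rewrite tri_S; lia]. Qed.

(** Trading the division for [tri] gives a form that is plainly computable and monotone: position
    [m] on the diagonal [n + m]. *)
Lemma cpair_tri n m : cpair n m = tri (n + m) + m.
Proof.
  unfold cpair. f_equal. symmetry. apply Nat.div_unique_exact; [lia|].
  induction (n + m) as [|s IH]; [reflexivity|]. rewrite tri_S. nia.
Qed.

Lemma diag_spec z : tri (diag z) <= z < tri (S (diag z)).
Proof.
  induction z as [|z IH]; [simpl; lia|].
  change (diag (S z)) with (ifz (diff (S z) (tri (S (diag z)))) (S (diag z)) (diag z)).
  unfold ifz. destruct (diff (S z) (tri (S (diag z)))) eqn:E; unfold diff in E.
  - rewrite (tri_S (S _)). lia.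
  - lia.
Qed.

Lemma diag_cpair a b : diag (cpair a b) = a + b.
Proof.
  pose proof (diag_spec (cpair a b)) as H. rewrite cpair_tri in *.
  set (d := diag _) in *. pose proof (tri_S (a + b)).
  destruct (lt_eq_lt_dec d (a + b)) as [[L|E]|L]; auto.
  - pose proof (tri_le (S d) (a + b) L). lia.
  - pose proof (tri_le (S (a + b)) d L). lia.
Qed.

Lemma csnd_cpair a b : csnd (cpair a b) = b.
Proof. unfold csnd. rewrite diag_cpair, cpair_tri. lia. Qed.

Lemma cfst_cpair a b : cfst (cpair a b) = a.
Proof. unfold cfst. rewrite diag_cpair, csnd_cpair. lia. Qed.

Lemma cpair_surjective z : cpair (cfst z) (csnd z) = z.
Proof.
  pose proof (diag_spec z) as H. rewrite tri_S in H.
  rewrite cpair_tri. unfold cfst.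
  assert (csnd z <= diag z) by (unfold csnd; lia).
  replace (diag z - csnd z + csnd z) with (diag z) by lia. unfold csnd. lia.
Qed.

Lemma cpair_mono a b a' b' : a <= a' -> b <= b' -> cpair a b <= cpair a' b'.
Proof.
  intros. rewrite !cpair_tri. pose proof (tri_le (a + b) (a' + b')). lia.
Qed.

Lemma cpair_ge a b : a <= cpair a b /\ b <= cpair a b.
Proof.
  rewrite cpair_tri. assert (a + b <= tri (a + b)); [|lia].
  induction (a + b); [auto | rewrite tri_S; lia].
Qed.

Lemma computable_tri : forall k F, computable k F -> computable k (fun v => tri (F v)).
Proof.
  apply computable_app1.
  apply (computable_rec 1 (fun v => 0) (fun v => nth 1 v 0 + S (nth 0 v 0)) (fun v => nth 0 v 0));
    computable_arith.
Qed.

Lemma computable_diag : forall k F, computable k F -> computable k (fun v => diag (F v)).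
Proof.
  apply computable_app1.
  apply (computable_rec 1 (fun v => 0)
    (fun v => ifz (diff (S (nth 0 v 0)) (tri (S (nth 1 v 0)))) (S (nth 1 v 0)) (nth 1 v 0))
    (fun v => nth 0 v 0));
  repeat first [computable_step | apply computable_ifz
               | apply computable_diff | apply computable_tri].
Qed.

Lemma computable_csnd k F : computable k F -> computable k (fun v => csnd (F v)).
Proof.
  intros. unfold csnd. apply computable_sub; auto. apply computable_tri, computable_diag; auto.
Qed.

Lemma computable_cfst k F : computable k F -> computable k (fun v => cfst (F v)).
Proof.
  intros. unfold cfst. apply computable_sub; [apply computable_diag | apply computable_csnd]; auto.
Qed.

Lemma computable_cpair k F G : computable k F -> computable k G ->
  computable k (fun v => cpair (F v) (G v)).
Proof.
  intros HF HG. eapply computable_ext; [intros v _; symmetry; apply cpair_tri|].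
  apply computable_add; auto. apply computable_tri. apply computable_add; auto.
Qed.

Definition chead (z : nat) : nat := cfst (pred z).
Definition ctail (z : nat) : nat := csnd (pred z).
Definition ccons (a z : nat) : nat := S (cpair a z).

Ltac computable_pairing :=
  unfold chead, ctail, ccons;
  repeat first [ computable_step | apply computable_cpair | apply computable_cfst
               | apply computable_csnd | apply computable_diff | apply computable_ifz
               | apply computable_pred | apply computable_add | apply computable_sub
               | apply computable_mul ].

Lemma chead_cons a w : chead (code_word (a :: w)) = a.
Proof. apply cfst_cpair. Qed.

Lemma ctail_cons a w : ctail (code_word (a :: w)) = code_word w.
Proof. apply csnd_cpair. Qed.

Lemma code_word_inj u v : code_word u = code_word v -> u = v.
Proof.
  revert v. induction u as [|a u IH]; intros [|b v] E; try discriminate; auto.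
  f_equal.
  - rewrite <- (chead_cons a u), E. apply chead_cons.
  - apply IH. rewrite <- (ctail_cons a u), E. apply ctail_cons.
Qed.

(** A decision procedure must answer on every number; together with [cpair_surjective] this makes
    every input the code of a pair of words. *)
Lemma code_word_surj z : exists w, code_word w = z.
Proof.
  induction z as [[|z] IH] using lt_wf_ind.
  - exists []. reflexivity.
  - destruct (IH (csnd z)) as [w Hw].
    + rewrite <- (cpair_surjective z) at 2.
      pose proof (cpair_ge (cfst z) (csnd z)). lia.
    + exists (cfst z :: w). simpl. now rewrite Hw, cpair_surjective.
Qed.

Lemma length_le_code w : length w <= code_word w.
Proof.
  induction w as [|a w IH]; simpl; auto.
  pose proof (cpair_ge a (code_word w)). lia.
Qed.

(** The code of the word consisting of [n] letters [k]; by monotonicity of [cpair] it dominates the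
    codes of all shorter words over smaller letters. *)
Definition code_bound (k n : nat) : nat := nat_rect (fun _ => nat) 0 (fun _ r => ccons k r) n.

Lemma code_le_bound k n w : letters_lt k w -> length w <= n -> code_word w <= code_bound k n.
Proof.
  intros Hw. revert n. induction Hw as [|a w Ha _ IH]; intros n Hn; simpl in *; [lia|].
  destruct n as [|n]; [lia|].
  change (code_bound k (S n)) with (S (cpair k (code_bound k n))).
  apply le_n_S, cpair_mono; [lia | apply IH; lia].
Qed.

Lemma computable_code_bound c : forall k F, computable k F ->
  computable k (fun v => code_bound c (F v)).
Proof.
  apply computable_app1.
  apply (computable_rec 1 (fun v => 0) (fun v => ccons c (nth 1 v 0)) (fun v => nth 0 v 0));
    computable_pairing.
Qed.

(** * Derivations of bounded length *)

(* A chain of at most [n] steps. *)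
Inductive chain {X : Type} (R : X -> X -> Prop) : nat -> X -> X -> Prop :=
| chain_refl n x : chain R n x x
| chain_step n x y z : R x y -> chain R n y z -> chain R (S n) x z.

Lemma chain_one {X} (R : X -> X -> Prop) x y : R x y -> chain R 1 x y.
Proof. intros H. econstructor; [exact H | constructor]. Qed.

Lemma chain_le {X} (R : X -> X -> Prop) n m x y : n <= m -> chain R n x y -> chain R m x y.
Proof.
  intros L H. revert m L. induction H as [|n x y z Hs H IH]; intros m L; [constructor|].
  destruct m as [|m]; [lia|]. econstructor; [exact Hs | apply IH; lia].
Qed.

Lemma chain_trans {X} (R : X -> X -> Prop) n m x y z :
  chain R n x y -> chain R m y z -> chain R (n + m) x z.
Proof.
  intros H H'. induction H as [|n x y y' Hs H IH].
  - eapply chain_le; [|exact H']. lia.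
  - simpl. econstructor; eauto.
Qed.

Lemma chain_sym {X} (R : X -> X -> Prop) n x y :
  (forall a b, R a b -> R b a) -> chain R n x y -> chain R n y x.
Proof.
  intros S H. induction H as [|n x y z Hs H IH]; [constructor|].
  rewrite <- Nat.add_1_r. eapply chain_trans; [exact IH|]. apply chain_one. auto.
Qed.

Lemma chain_map {X Y} (R : X -> X -> Prop) (R' : Y -> Y -> Prop) (f : X -> Y) n x y :
  (forall a b, R a b -> R' (f a) (f b)) -> chain R n x y -> chain R' n (f x) (f y).
Proof.
  intros Hf H. induction H as [|n x y z Hs H IH]; [constructor|].
  econstructor; eauto.
Qed.

(** Listing both orientations makes a single step symmetric, so that a derivation is a plain
    sequence of rule applications. *)
Definition rules (Rel : list (list nat * list nat)) : list (list nat * list nat) :=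
  Rel ++ map (fun lr => (snd lr, fst lr)) Rel.

Lemma in_rules Rel l r : In (l, r) (rules Rel) <-> In (l, r) Rel \/ In (r, l) Rel.
Proof.
  unfold rules. rewrite in_app_iff, in_map_iff. split; (intros [H|H]; [auto|]).
  - destruct H as [[a b] [E H]]. simpl in E. injection E as -> ->. auto.
  - right. exists (r, l). auto.
Qed.

Definition rstep (Rel : list (list nat * list nat)) (u v : list nat) : Prop :=
  exists p l r s, In (l, r) (rules Rel) /\ u = p ++ l ++ s /\ v = p ++ r ++ s.

Lemma rstep_sym Rel u v : rstep Rel u v -> rstep Rel v u.
Proof.
  intros (p & l & r & s & H & -> & ->). exists p, r, l, s. split; auto.
  rewrite in_rules in *. tauto.
Qed.

Lemma rstep_context Rel a b u v : rstep Rel u v -> rstep Rel (a ++ u ++ b) (a ++ v ++ b).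
Proof.
  intros (p & l & r & s & H & -> & ->). exists (a ++ p), l, r, (s ++ b).
  now rewrite <- !app_assoc.
Qed.

Lemma rcong_chain Rel u v : rcong Rel u v <-> exists t, chain (rstep Rel) t u v.
Proof.
  split.
  - induction 1 as [u|u v _ [t IH]|u v w _ [t IH] _ [t' IH']|p l r s H].
    + exists 0. constructor.
    + exists t. apply chain_sym; auto using rstep_sym.
    + exists (t + t'). eapply chain_trans; eauto.
    + exists 1. apply chain_one. exists p, l, r, s. rewrite in_rules. auto.
  - intros [t H]. induction H as [|n u v w (p & l & r & s & H & -> & ->) _ IH]; [constructor|].
    eapply rc_trans; [|exact IH]. apply in_rules in H. destruct H as [H|H].
    + now apply rc_step.
    + now apply rc_sym, rc_step.
Qed.

Definition rel_over (k : nat) (Rel : list (list nat * list nat)) : Prop :=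
  Forall (fun lr => letters_lt k (fst lr) /\ letters_lt k (snd lr)) Rel.

Lemma letters_app k u v : letters_lt k (u ++ v) <-> letters_lt k u /\ letters_lt k v.
Proof. apply Forall_app. Qed.

Lemma rules_over k Rel l r : rel_over k Rel -> In (l, r) (rules Rel) ->
  letters_lt k l /\ letters_lt k r.
Proof.
  intros HR H. unfold rel_over in HR. rewrite Forall_forall in HR.
  apply in_rules in H. destruct H as [H|H]; apply HR in H; simpl in H; tauto.
Qed.

Lemma rstep_letters k Rel u v : rel_over k Rel -> rstep Rel u v ->
  letters_lt k u -> letters_lt k v.
Proof.
  intros HR (p & l & r & s & H & -> & ->). rewrite !letters_app.
  pose proof (rules_over k Rel l r HR H). tauto.
Qed.

Lemma rules_length_bound (Rel : list (list nat * list nat)) :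
  exists C, forall l r, In (l, r) Rel -> length l <= C /\ length r <= C.
Proof.
  induction Rel as [|[l r] Rel [C IH]].
  - exists 0. intros ? ? [].
  - exists (length l + length r + C). intros l' r' [E|H].
    + injection E as -> ->. lia.
    + specialize (IH _ _ H). lia.
Qed.

(** * A zipper machine running derivations *)

(* The state [(p, s)] is the word [rev p ++ s] with a cursor between [p] and [s].
   Instruction 0 moves the cursor right (only over letters below [k]), 1 moves it left,
   [2 + j] applies the j-th rule at the cursor; an instruction that cannot be
   executed does nothing. *)

Fixpoint strip (l s : list nat) : option (list nat) :=
  match l, s with
  | [], _ => Some s
  | a :: l', b :: s' => if b =? a then strip l' s' else None
  | _ :: _, [] => None
  end.

Fixpoint rewrite_head (RR : list (list nat * list nat)) (j : nat) (s : list nat) : list nat :=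
  match RR, j with
  | [], _ => s
  | (l, r) :: _, 0 => match strip l s with Some t => r ++ t | None => s end
  | _ :: RR', S j' => rewrite_head RR' j' s
  end.

Definition zstep (k : nat) (RR : list (list nat * list nat)) (o : nat)
    (z : list nat * list nat) : list nat * list nat :=
  let (p, s) := z in
  match o with
  | 0 => match s with [] => z | a :: s' => if a <? k then (a :: p, s') else z end
  | 1 => match p with [] => z | a :: p' => (p', a :: s) end
  | S (S j) => (p, rewrite_head RR j s)
  end.

Definition zrun k RR (os : list nat) (z : list nat * list nat) : list nat * list nat :=
  fold_left (fun z o => zstep k RR o z) os z.

Lemma zrun_app k RR os os' z : zrun k RR (os ++ os') z = zrun k RR os' (zrun k RR os z).
Proof. apply fold_left_app. Qed.

Lemma strip_Some l s t : strip l s = Some t -> s = l ++ t.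
Proof.
  revert s. induction l as [|a l IH]; intros s E; simpl in *; [congruence|].
  destruct s as [|b s]; [discriminate|].
  destruct (Nat.eqb_spec b a); [|discriminate]. subst. simpl. f_equal. auto.
Qed.

Lemma strip_app l t : strip l (l ++ t) = Some t.
Proof. induction l as [|a l IH]; simpl; auto. now rewrite Nat.eqb_refl. Qed.

Lemma rewrite_head_spec RR j s :
  rewrite_head RR j s = s \/
  exists l r t, In (l, r) RR /\ s = l ++ t /\ rewrite_head RR j s = r ++ t.
Proof.
  revert j. induction RR as [|[l r] RR IH]; intros [|j]; simpl; auto.
  - destruct (strip l s) as [t|] eqn:E; auto. apply strip_Some in E. right. eauto 7.
  - destruct (IH j) as [H|(l' & r' & t & H & E)]; auto. right. eauto 7.
Qed.

Lemma rewrite_head_out RR j s : length RR <= j -> rewrite_head RR j s = s.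
Proof.
  revert j. induction RR as [|[l r] RR IH]; intros [|j]; simpl; intros; auto; try lia.
  apply IH. lia.
Qed.

Lemma rewrite_head_in RR l r : In (l, r) RR ->
  exists j, j < length RR /\ forall t, rewrite_head RR j (l ++ t) = r ++ t.
Proof.
  induction RR as [|[l' r'] RR IH]; [intros []|]. intros [E|H].
  - injection E as -> ->. exists 0. simpl. split; [lia|]. intros t. now rewrite strip_app.
  - destruct (IH H) as (j & Hj & E). exists (S j). simpl. split; [lia | auto].
Qed.

(** Each instruction either keeps the underlying word or applies one rule to it. Hence every run, of
    whatever program, certifies a derivation. *)
Lemma zrun_sound k Rel os z :
  chain (rstep Rel) (length os) (rev (fst z) ++ snd z)
    (rev (fst (zrun k (rules Rel) os z)) ++ snd (zrun k (rules Rel) os z)).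
Proof.
  revert z. induction os as [|o os IH]; intros z; [constructor|].
  change (zrun k (rules Rel) (o :: os) z)
    with (zrun k (rules Rel) os (zstep k (rules Rel) o z)).
  specialize (IH (zstep k (rules Rel) o z)).
  assert (H : rev (fst z) ++ snd z
     = rev (fst (zstep k (rules Rel) o z)) ++ snd (zstep k (rules Rel) o z)
   \/ rstep Rel (rev (fst z) ++ snd z)
       (rev (fst (zstep k (rules Rel) o z)) ++ snd (zstep k (rules Rel) o z))).
  { destruct z as [p s]. destruct o as [|[|j]]; simpl.
    - destruct s as [|a s]; auto. destruct (a <? k); auto. simpl.
      rewrite <- app_assoc. auto.
    - destruct p as [|a p]; auto. simpl. rewrite <- app_assoc. auto.
    - destruct (rewrite_head_spec (rules Rel) j s) as [E|(l & r & t & H & E & E')].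
      + rewrite E. auto.
      + right. exists (rev p), l, r, t. rewrite E'. subst. auto. }
  destruct H as [E|H].
  - rewrite E. eapply chain_le; [|exact IH]. simpl. lia.
  - simpl. econstructor; eauto.
Qed.

Lemma zrun_right k RR p q s : letters_lt k p ->
  zrun k RR (repeat 0 (length p)) (q, p ++ s) = (rev p ++ q, s).
Proof.
  intros Hp. revert q. induction Hp as [|a p Ha _ IH]; intros q; [reflexivity|].
  simpl. apply Nat.ltb_lt in Ha. rewrite Ha. rewrite <- app_assoc. apply IH.
Qed.

Lemma zrun_left k RR p q s :
  zrun k RR (repeat 1 (length p)) (p ++ q, s) = (q, rev p ++ s).
Proof.
  revert s. induction p as [|a p IH]; intros s; [reflexivity|].
  simpl. rewrite <- app_assoc. apply IH.
Qed.

(** The cursor gets stuck before the first letter that is not below [k], so moving right doubles as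
    the test that a word is over the alphabet. *)
Lemma zrun_check k RR T p s : length s <= T ->
  (snd (zrun k RR (repeat 0 T) (p, s)) = [] <-> letters_lt k s).
Proof.
  revert p s. induction T as [|T IH]; intros p s L.
  - destruct s; simpl in *; [|lia]. split; constructor.
  - destruct s as [|a s]; simpl in *.
    + rewrite (IH p [] ltac:(simpl; lia)). split; auto.
    + destruct (Nat.ltb_spec a k) as [Ha|Ha].
      * rewrite IH by lia. split; [intros; constructor; auto | inversion 1; auto].
      * assert (E : forall T, zrun k RR (repeat 0 T) (p, a :: s) = (p, a :: s)).
        { clear -Ha. induction T as [|T IH]; [reflexivity|]. simpl.
          destruct (Nat.ltb_spec a k); [lia | exact IH]. }
        rewrite E. split; [discriminate|]. inversion 1. lia.
Qed.

(** There is no rule number [length RR], so this instruction idles. It pads programs to a prescribed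
    length. *)
Lemma zrun_nop k RR m z : zrun k RR (repeat (2 + length RR) m) z = z.
Proof.
  induction m as [|m IH]; [reflexivity|]. destruct z as [p s]. simpl.
  rewrite rewrite_head_out by lia. exact IH.
Qed.

(** During [t] steps the word stays no longer than [n + t * C], and each step costs a walk to the
    place of rewriting, one instruction and the walk back. *)
Definition zipper_time (C n t : nat) : nat := t * (2 * (n + t * C) + 1).

Lemma zipper_time_S C n n' t : n' <= n + C ->
  2 * n + 1 + zipper_time C n' t <= zipper_time C n (S t).
Proof. unfold zipper_time. intros. nia. Qed.

Lemma zrun_complete k Rel C t u v :
  rel_over k Rel -> (forall l r, In (l, r) (rules Rel) -> length l <= C /\ length r <= C) ->
  letters_lt k u -> chain (rstep Rel) t u v ->
  exists os, length os <= zipper_time C (length u) t /\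
    letters_lt (3 + length (rules Rel)) os /\
    zrun k (rules Rel) os ([], u) = ([], v).
Proof.
  intros HR HC Hu H.
  induction H as [t u|t u u' v Hs H IH].
  - exists []. simpl. split; [lia|]. split; [constructor | reflexivity].
  - destruct (IH (rstep_letters _ _ _ _ HR Hs Hu)) as (os & L & Ho & E).
    destruct Hs as (p & l & r & s & Hin & -> & ->).
    destruct (HC _ _ Hin) as [_ Lr].
    destruct (rewrite_head_in _ _ _ Hin) as (j & Hj & Ej).
    exists (repeat 0 (length p) ++ [2 + j] ++ repeat 1 (length (rev p)) ++ os).
    rewrite !length_app, !repeat_length, length_rev in *. simpl length. split; [|split].
    + pose proof (zipper_time_S C (length p + (length l + length s))
                    (length p + (length r + length s)) t). lia.
    + rewrite !letters_app. repeat split; auto.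
      * apply Forall_forall. intros x Hx. apply repeat_spec in Hx. lia.
      * constructor; [lia | constructor].
      * apply Forall_forall. intros x Hx. apply repeat_spec in Hx. lia.
    + rewrite !zrun_app. apply letters_app in Hu. rewrite zrun_right by tauto.
      simpl (zrun k (rules Rel) [2 + j] _). rewrite app_nil_r, Ej.
      rewrite <- (app_nil_r (rev p)), <- (length_rev p), zrun_left, rev_involutive. exact E.
Qed.

(** * The zipper machine as an arithmetic function on codes *)

Fixpoint cstrip (l : list nat) (s : nat) : nat :=
  match l with
  | [] => S s
  | a :: l' => ifz s 0 (ifz (diff (chead s) a) (cstrip l' (ctail s)) 0)
  end.

Fixpoint cpush (r : list nat) (s : nat) : nat :=
  match r with [] => s | a :: r' => ccons a (cpush r' s) end.

Fixpoint crewrite (RR : list (list nat * list nat)) (j s : nat) : nat :=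
  match RR with
  | [] => s
  | (l, r) :: RR' =>
      ifz j (ifz (cstrip l s) s (cpush r (pred (cstrip l s)))) (crewrite RR' (pred j) s)
  end.

(** The test [S a - k] is zero exactly when [a < k]; nested [ifz] replace the matches of [zstep]. *)
Definition cstep (k : nat) (RR : list (list nat * list nat)) (o z : nat) : nat :=
  ifz o
    (ifz (csnd z) z
       (ifz (S (chead (csnd z)) - k)
          (cpair (ccons (chead (csnd z)) (cfst z)) (ctail (csnd z))) z))
    (ifz (pred o)
       (ifz (cfst z) z (cpair (ctail (cfst z)) (ccons (chead (cfst z)) (csnd z))))
       (cpair (cfst z) (crewrite RR (pred (pred o)) (csnd z)))).

Definition cnth (d i : nat) : nat := chead (nat_rect (fun _ => nat) d (fun _ r => ctail r) i).

Definition crun k RR (T d z : nat) : nat :=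
  nat_rect (fun _ => nat) z (fun i r => cstep k RR (cnth d i) r) T.

Definition enc (z : list nat * list nat) : nat := cpair (code_word (fst z)) (code_word (snd z)).

Lemma enc_inj z z' : enc z = enc z' -> z = z'.
Proof.
  destruct z as [p s], z' as [p' s']. unfold enc. simpl. intros E.
  f_equal; apply code_word_inj.
  - rewrite <- (cfst_cpair (code_word p) (code_word s)), E. apply cfst_cpair.
  - rewrite <- (csnd_cpair (code_word p) (code_word s)), E. apply csnd_cpair.
Qed.

Lemma ifz_diff a b x y : ifz (diff a b) x y = if a =? b then x else y.
Proof.
  destruct (Nat.eqb_spec a b) as [->|H].
  - unfold diff. now rewrite Nat.sub_diag.
  - destruct (diff a b) eqn:E; [unfold diff in E; lia | reflexivity].
Qed.

(** Success is shifted by one, so that 0 is free to mean failure even though the empty remainder has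
    code 0. *)
Lemma cstrip_code l s :
  cstrip l (code_word s) = match strip l s with None => 0 | Some t => S (code_word t) end.
Proof.
  revert s. induction l as [|a l IH]; intros s; [reflexivity|].
  destruct s as [|b s]; [reflexivity|].
  cbn [cstrip strip]. rewrite chead_cons, ctail_cons, ifz_diff. simpl.
  destruct (b =? a); auto.
Qed.

Lemma cpush_code r s : cpush r (code_word s) = code_word (r ++ s).
Proof. induction r as [|a r IH]; simpl; [auto | now rewrite IH]. Qed.

Lemma crewrite_code RR j s : crewrite RR j (code_word s) = code_word (rewrite_head RR j s).
Proof.
  revert j. induction RR as [|[l r] RR IH]; intros [|j]; simpl; auto.
  rewrite cstrip_code. destruct (strip l s); simpl; auto. apply cpush_code.
Qed.

Lemma cstep_enc k RR o z : cstep k RR o (enc z) = enc (zstep k RR o z).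
Proof.
  destruct z as [p s]. unfold cstep, enc. rewrite cfst_cpair, csnd_cpair.
  cbn [fst snd]. destruct o as [|[|j]]; cbn [ifz pred zstep].
  - destruct s as [|a s]; [reflexivity|]. rewrite chead_cons, ctail_cons.
    destruct (Nat.ltb_spec a k).
    + replace (S a - k) with 0 by lia. reflexivity.
    + destruct (S a - k) eqn:E; [lia | reflexivity].
  - destruct p as [|a p]; [reflexivity|]. rewrite chead_cons, ctail_cons. reflexivity.
  - rewrite crewrite_code. reflexivity.
Qed.

Lemma cnth_code w i : cnth (code_word w) i = nth i w 0.
Proof.
  enough (E : forall i, nat_rect (fun _ => nat) (code_word w) (fun _ r => ctail r) i
                = code_word (skipn i w)).
  { unfold cnth. rewrite E. clear E. revert w. induction i as [|i IH]; intros [|a w]; auto.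
    - apply chead_cons.
    - apply IH. }
  clear i. induction i as [|i IH]; [reflexivity|].
  cbn [nat_rect]. rewrite IH. clear IH. revert w.
  induction i as [|i IH]; intros [|a w]; auto.
  - apply ctail_cons.
  - apply IH.
Qed.

(** Every number [d] is a program: entries beyond its end read as 0, so the first [T] entries always
    form an instruction list and no validity test is needed. *)
Lemma crun_enc k RR T d z :
  crun k RR T d (enc z) = enc (zrun k RR (map (cnth d) (seq 0 T)) z).
Proof.
  induction T as [|T IH]; [reflexivity|].
  rewrite seq_S, map_app, zrun_app. unfold crun in *. simpl.
  rewrite IH. apply cstep_enc.
Qed.

Lemma crun_code k RR os z :
  crun k RR (length os) (code_word os) (enc z) = enc (zrun k RR os z).
Proof.
  rewrite crun_enc. do 2 f_equal. rewrite <- (map_nth_seq os) at 3.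
  apply map_ext. apply cnth_code.
Qed.

Lemma crun_zero k RR T z : crun k RR T 0 (enc z) = enc (zrun k RR (repeat 0 T) z).
Proof.
  rewrite crun_enc. do 2 f_equal. rewrite <- (length_seq T 0) at 2. generalize (seq 0 T).
  intros l. induction l as [|i l IH]; [reflexivity|]. cbn [map length repeat]. rewrite IH.
  f_equal. etransitivity; [exact (cnth_code [] i) | now destruct i].
Qed.

(** The word [l] is a fixed parameter, so the recursion on it merely unfolds into a finite
    composition. The same applies to [cpush] and [crewrite]. *)
Lemma computable_cstrip l k F : computable k F -> computable k (fun v => cstrip l (F v)).
Proof.
  revert F. induction l as [|a l IH]; intros F HF; simpl; computable_pairing.
  apply IH. computable_pairing.
Qed.

Lemma computable_cpush r k F : computable k F -> computable k (fun v => cpush r (F v)).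
Proof.
  revert F. induction r as [|a r IH]; intros F HF; simpl; auto.
  computable_pairing. auto.
Qed.

Lemma computable_crewrite RR k F G : computable k F -> computable k G ->
  computable k (fun v => crewrite RR (F v) (G v)).
Proof.
  revert F. induction RR as [|[l r] RR IH]; intros F HF HG; simpl; auto.
  apply computable_ifz; auto.
  - apply computable_ifz; auto using computable_cstrip.
    auto using computable_cpush, computable_pred, computable_cstrip.
  - apply (IH (fun v => pred (F v))); auto using computable_pred.
Qed.

Lemma computable_cstep c RR k F G : computable k F -> computable k G ->
  computable k (fun v => cstep c RR (F v) (G v)).
Proof.
  intros. unfold cstep.
  repeat first [apply computable_crewrite | progress computable_pairing].
Qed.

Lemma computable_cnth : forall k F G, computable k F -> computable k G ->
  computable k (fun v => cnth (F v) (G v)).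
Proof.
  apply computable_app2. unfold cnth. apply computable_cfst, computable_pred.
  apply (computable_rec 2 (fun v => nth 0 v 0) (fun v => ctail (nth 1 v 0)) (fun v => nth 1 v 0));
    computable_pairing.
Qed.

Lemma computable_crun c RR : forall k F G H,
  computable k F -> computable k G -> computable k H ->
  computable k (fun v => crun c RR (F v) (G v) (H v)).
Proof.
  apply computable_app3.
  apply (computable_rec 3 (fun v => nth 2 v 0)
    (fun v => cstep c RR (cnth (nth 3 v 0) (nth 0 v 0)) (nth 1 v 0)) (fun v => nth 0 v 0));
    try computable_step.
  apply computable_cstep; [apply computable_cnth|]; computable_step.
Qed.

(** * Word problem and computable bounds on derivations *)

(** [T] is an upper bound for the Dehn function of the presentation, counting rule applications in
    either direction. *)
Definition dehn_bound (k : nat) (Rel : list (list nat * list nat)) (T : nat -> nat) : Prop :=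
  forall n u v, letters_lt k u -> letters_lt k v -> length u <= n -> length v <= n ->
    rcong Rel u v -> chain (rstep Rel) (T n) u v.

(** A sum over all smaller codes is a convenient computable substitute for a maximum. *)
Lemma le_sum_below (D : nat -> nat) c m : c < m ->
  D c <= nat_rect (fun _ => nat) 0 (fun n r => r + D n) m.
Proof.
  induction 1; simpl; lia.
Qed.

(** An unbounded search finds a derivation of each true equation; solvability of the word problem
    makes this search total. Summing the results over all codes of equations of the given size gives
    the bound. *)
Lemma dehn_bound_of_solvable k Rel :
  rel_over k Rel -> solvable_word_problem k Rel ->
  exists T, computable 1 (fun v => T (nth 0 v 0)) /\ dehn_bound k Rel T.
Proof.
  intros HR [f Hf].
  set (P n := exists u v, letters_lt k u /\ letters_lt k v /\
                n = cpair (code_word u) (code_word v) /\ rcong Rel u v) in Hf.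
  (* The characteristic function is defined classically; the given program [f] then shows that it is
     computable. *)
  set (chi n := if excluded_middle_informative (P n) then 1 else 0).
  assert (Hchi : computable 1 (fun v => chi (nth 0 v 0))).
  { exists f. intros [|n [|? ?]] L; try discriminate. simpl. unfold chi.
    destruct excluded_middle_informative; now apply Hf. }
  pose proof (computable_app1 chi Hchi) as Hchi'.
  (* Argument 1 is the coded equation, argument 0 a candidate pair of running time and program. On
     false equations [F] is 0, so the search stops at once. *)
  set (F v := ifz (chi (nth 1 v 0)) 0
    (diff (crun k (rules Rel) (cfst (nth 0 v 0)) (csnd (nth 0 v 0))
             (cpair 0 (cfst (nth 1 v 0)))) (cpair 0 (csnd (nth 1 v 0))))).
  destruct (computable_min 1 F) as (m & Hm & Hm0).
  { unfold F. apply computable_ifz; [apply Hchi'; computable_step | computable_step |].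
    apply computable_diff; [apply computable_crun|]; computable_pairing. }
  { intros [|c [|? ?]] L; try discriminate. unfold F. simpl nth. unfold chi.
    destruct excluded_middle_informative as [(u & v & Hu & Hv & -> & Huv)|]; [|now exists 0].
    apply rcong_chain in Huv. destruct Huv as [t Ht].
    destruct (rules_length_bound (rules Rel)) as [C HC].
    destruct (zrun_complete k Rel C t u v HR HC Hu Ht) as (os & _ & _ & E).
    exists (cpair (length os) (code_word os)).
    rewrite !cfst_cpair, !csnd_cpair.
    change (cpair 0 (code_word u)) with (enc ([], u)).
    change (cpair 0 (code_word v)) with (enc ([], v)).
    rewrite crun_code, E. simpl. unfold diff. lia. }
  set (D c := m [c]).
  assert (HD : computable 1 (fun v => D (nth 0 v 0))).
  { eapply computable_ext; [|exact Hm]. intros [|c [|? ?]] L; try discriminate. reflexivity. }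
  (* The sum runs over numbers strictly below its limit; the successor includes the largest possible
     code of an equation. *)
  exists (fun n => nat_rect (fun _ => nat) 0 (fun n r => r + D n)
            (S (cpair (code_bound k n) (code_bound k n)))).
  split.
  - apply (computable_rec 1 (fun v => 0) (fun v => nth 1 v 0 + D (nth 0 v 0))
      (fun v => S (cpair (code_bound k (nth 0 v 0)) (code_bound k (nth 0 v 0)))));
      computable_pairing.
    + apply (computable_app1 D HD). computable_step.
    + apply computable_code_bound. computable_step.
    + apply computable_code_bound. computable_step.
  - intros n u v Hu Hv Lu Lv Huv.
    set (c := cpair (code_word u) (code_word v)).
    eapply chain_le; [apply (le_sum_below D c)|].
    { apply Nat.lt_succ_r, cpair_mono; now apply code_le_bound. }
    pose proof (Hm0 [c] eq_refl) as E. fold (D c) in E. unfold F in E. simpl nth in E.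
    unfold chi in E. destruct excluded_middle_informative as [_|H].
    2:{ exfalso. apply H. exists u, v. auto. }
    replace (cfst c) with (code_word u) in E by (symmetry; apply cfst_cpair).
    replace (csnd c) with (code_word v) in E by (symmetry; apply csnd_cpair).
    cbn [ifz] in E.
    change (cpair 0 (code_word u)) with (enc ([], u)) in E.
    change (cpair 0 (code_word v)) with (enc ([], v)) in E.
    rewrite crun_enc in E. set (os := map _ _) in E.
    assert (E' : zrun k (rules Rel) os ([], u) = ([], v))
      by (apply enc_inj; unfold diff in E; lia).
    pose proof (zrun_sound k Rel os ([], u)) as H. rewrite E' in H. simpl in H.
    (* The number found pairs a running time with a program, so it is at least the running time,
       which bounds the number of derivation steps. *)
    eapply chain_le; [|exact H]. unfold os. rewrite length_map, length_seq.
    rewrite <- (cpair_surjective (D c)) at 2.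
    apply cpair_ge.
Qed.

Definition some_below (g : nat -> nat) (m : nat) : nat :=
  nat_rect (fun _ => nat) 0 (fun n r => ifz (g n) 1 r) m.

Lemma some_below_spec g m :
  (some_below g m = 1 /\ exists d, d < m /\ g d = 0) \/
  (some_below g m = 0 /\ forall d, d < m -> g d <> 0).
Proof.
  induction m as [|m IH]; [right; split; [reflexivity | lia]|].
  change (some_below g (S m)) with (ifz (g m) 1 (some_below g m)).
  destruct (g m) eqn:E; simpl.
  - left. split; [reflexivity|]. exists m. split; [lia | exact E].
  - destruct IH as [[H [d [L Hd]]]|[H Hd]].
    + left. split; auto. exists d. split; [lia | auto].
    + right. split; auto. intros d L. destruct (Nat.eq_dec d m) as [->|]; [lia|]. apply Hd. lia.
Qed.

(** A bound on derivations bounds the length of the programs realizing them, hence their codes, so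
    trying all codes up to a computable limit decides an equation. *)
Lemma solvable_of_dehn_bound k Rel T :
  rel_over k Rel -> computable 1 (fun v => T (nth 0 v 0)) -> dehn_bound k Rel T ->
  solvable_word_problem k Rel.
Proof.
  intros HR HT HB.
  pose proof (computable_app1 T HT) as HT'.
  destruct (rules_length_bound (rules Rel)) as [C HC].
  (* Two moves, one instruction per rule, and the idle instruction. *)
  set (K := 3 + length (rules Rel)).
  set (run := crun k (rules Rel)).
  (* It will be used at the input [c] itself, which is at least the length of both words that it
     codes. *)
  set (time n := zipper_time C n (T n)).
  set (search c := some_below (fun d => diff (run (time c) d (cpair 0 (cfst c)))
                     (cpair 0 (csnd c))) (S (code_bound K (time c)))).
  (* The program 0 reads as moves to the right only, and [z] of them suffice because a code is at
     least the length of its word. *)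
  set (bad z := csnd (run z 0 (cpair 0 z))).
  set (dec c := ifz (bad (cfst c)) (ifz (bad (csnd c)) (search c) 0) 0).
  assert (Htime : forall j F, computable j F -> computable j (fun v => time (F v))).
  { intros j F HF. unfold time, zipper_time. specialize (HT' j F HF). computable_arith. }
  assert (Hsearch : computable 1 (fun v => search (nth 0 v 0))).
  { apply (computable_rec 1 (fun v => 0)
      (fun v => ifz (diff (run (time (nth 2 v 0)) (nth 0 v 0) (cpair 0 (cfst (nth 2 v 0))))
                      (cpair 0 (csnd (nth 2 v 0)))) 1 (nth 1 v 0))
      (fun v => S (code_bound K (time (nth 0 v 0))))); try computable_step.
    - apply computable_ifz; try computable_step.
      apply computable_diff; [|computable_pairing].
      apply computable_crun; [apply Htime| |]; computable_pairing.
    - apply computable_code_bound, Htime. computable_step. }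
  assert (Hbad : forall j F, computable j F -> computable j (fun v => bad (F v))).
  { intros j F HF. apply computable_csnd, computable_crun; computable_pairing. }
  assert (Hdec : computable 1 (fun v => dec (nth 0 v 0))).
  { unfold dec. apply computable_ifz; [|apply computable_ifz; [|exact Hsearch|]|];
      try computable_step; apply Hbad; computable_pairing. }
  assert (Ebad : forall w, bad (code_word w) = 0 <-> letters_lt k w).
  { intros w. unfold bad, run. change (cpair 0 (code_word w)) with (enc ([], w)).
    rewrite crun_zero. unfold enc. rewrite csnd_cpair.
    rewrite <- (zrun_check k (rules Rel) (code_word w) [] w (length_le_code w)).
    split; [|now intros ->]. intros E. now apply code_word_inj. }
  destruct Hdec as [f Hf]. exists f. intros c. specialize (Hf [c] eq_refl). simpl in Hf.
  enough (E : (dec c = 1 /\ exists u v, letters_lt k u /\ letters_lt k v /\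
                c = cpair (code_word u) (code_word v) /\ rcong Rel u v) \/
              (dec c = 0 /\ ~ exists u v, letters_lt k u /\ letters_lt k v /\
                c = cpair (code_word u) (code_word v) /\ rcong Rel u v)).
  { destruct E as [[E H]|[E H]]; rewrite E in Hf; tauto. }
  destruct (code_word_surj (cfst c)) as [u Eu], (code_word_surj (csnd c)) as [v Ev].
  assert (Ec : c = cpair (code_word u) (code_word v)) by now rewrite Eu, Ev, cpair_surjective.
  assert (U : (exists u v, letters_lt k u /\ letters_lt k v /\
                c = cpair (code_word u) (code_word v) /\ rcong Rel u v) <->
              (letters_lt k u /\ letters_lt k v /\ rcong Rel u v)).
  { split; [|intros (? & ? & ?); exists u, v; auto].
    intros (u' & v' & Hu & Hv & E & H). rewrite Ec in E.
    assert (Q : (u, v) = (u', v')) by (apply enc_inj; exact E).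
    injection Q as -> ->. auto. }
  rewrite U. unfold dec. rewrite <- Eu, <- Ev.
  destruct (bad (code_word u)) eqn:Bu; simpl.
  2:{ right. split; auto. intros [H _]. apply Ebad in H. lia. }
  destruct (bad (code_word v)) eqn:Bv; simpl.
  2:{ right. split; auto. intros (_ & H & _). apply Ebad in H. lia. }
  apply Ebad in Bu, Bv.
  assert (S : (exists d, d < S (code_bound K (time c)) /\
     diff (run (time c) d (cpair 0 (cfst c))) (cpair 0 (csnd c)) = 0) <-> rcong Rel u v).
  { rewrite <- Eu, <- Ev.
    change (cpair 0 (code_word u)) with (enc ([], u)).
    change (cpair 0 (code_word v)) with (enc ([], v)). split.
    - intros (d & _ & E). unfold run in E. rewrite crun_enc in E. set (os := map _ _) in E.
      assert (E' : zrun k (rules Rel) os ([], u) = ([], v))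
        by (apply enc_inj; unfold diff in E; lia).
      pose proof (zrun_sound k Rel os ([], u)) as H. rewrite E' in H.
      apply rcong_chain. eauto.
    - intros H.
      assert (Lu : length u <= c /\ length v <= c).
      { pose proof (length_le_code u). pose proof (length_le_code v).
        pose proof (cpair_ge (code_word u) (code_word v)). rewrite <- Ec in *. lia. }
      apply (HB c u v) in H; try tauto.
      destruct (zrun_complete k Rel C (T c) u v HR HC Bu H) as (os & L & Ho & E).
      set (nops := repeat (2 + length (rules Rel)) (time c - length os)).
      assert (Lt : length os <= time c).
      { etransitivity; [exact L|]. unfold time, zipper_time. apply Nat.mul_le_mono_l. lia. }
      assert (Ln : length (os ++ nops) = time c)
        by (unfold nops; rewrite length_app, repeat_length; lia).
      exists (code_word (os ++ nops)). split.
      + apply Nat.lt_succ_r, code_le_bound; [|lia].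
        apply letters_app. split; auto. apply Forall_forall. intros x Hx.
        apply repeat_spec in Hx. unfold K. lia.
      + rewrite <- Ln. unfold run. rewrite crun_code, zrun_app, E.
        unfold nops. rewrite zrun_nop. unfold diff. lia. }
  unfold search. destruct (some_below_spec (fun d => diff (run (time c) d (cpair 0 (cfst c)))
                     (cpair 0 (csnd c))) (Datatypes.S (code_bound K (time c)))) as [[E H]|[E H]].
  - left. split; [exact E|]. apply S in H. auto.
  - right. split; [exact E|]. intros (_ & _ & R). apply S in R.
    destruct R as (d & L & Ed). exact (H d L Ed).
Qed.

(** * Paths in Cayley graphs *)

Definition act (M : monoid) (gens : list M) (x : M) (w : list nat) : M :=
  mmul M x (pres_eval M gens w).

Definition spans (M : monoid) (gens : list M) : Prop :=
  forall x : M, exists w, letters_lt (length gens) w /\ pres_eval M gens w = x.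

Lemma act_nil M gens x : act M gens x [] = x.
Proof. apply mulm1. Qed.

Lemma act_cons M gens x i w :
  act M gens x (i :: w) = act M gens (mmul M x (nth i gens (munit M))) w.
Proof. apply massoc. Qed.

Lemma act_app M gens x u v : act M gens x (u ++ v) = act M gens (act M gens x u) v.
Proof.
  revert x. induction u as [|i u IH]; intros x; simpl app.
  - now rewrite act_nil.
  - now rewrite !act_cons.
Qed.

Lemma act_one M gens w : act M gens (munit M) w = pres_eval M gens w.
Proof. apply mul1m. Qed.

Lemma pres_eval_app M gens u v :
  pres_eval M gens (u ++ v) = mmul M (pres_eval M gens u) (pres_eval M gens v).
Proof. rewrite <- !(act_one M gens (_ ++ _)), act_app, act_one. reflexivity. Qed.

Lemma choose {X Y : Type} (P : X -> Y -> Prop) :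
  (forall x, exists y, P x y) -> exists f, forall x, P x (f x).
Proof.
  intros H. exists (fun x => proj1_sig (constructive_indefinite_description _ (H x))).
  intros x. destruct constructive_indefinite_description. auto.
Qed.

(** The exchanged subpaths need to agree only when started at the vertex reached by [p], not as
    elements of the monoid. This local condition is what a quasi-isometry can transport. *)
Definition hstep (M : monoid) (gens : list M) (C : nat) (x : M) (u v : list nat) : Prop :=
  exists p l r s, u = p ++ l ++ s /\ v = p ++ r ++ s /\
    length l <= C /\ length r <= C /\
    letters_lt (length gens) l /\ letters_lt (length gens) r /\
    act M gens x (p ++ l) = act M gens x (p ++ r).

Lemma hstep_base M gens C x l r :
  length l <= C -> length r <= C ->
  letters_lt (length gens) l -> letters_lt (length gens) r ->
  act M gens x l = act M gens x r -> hstep M gens C x l r.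
Proof. intros. exists [], l, r, []. rewrite !app_nil_r. simpl. repeat split; auto. Qed.

Lemma hstep_sym M gens C x u v : hstep M gens C x u v -> hstep M gens C x v u.
Proof. intros (p & l & r & s & H). exists p, r, l, s. intuition congruence. Qed.

Lemma hstep_le M gens C C' x u v : C <= C' -> hstep M gens C x u v -> hstep M gens C' x u v.
Proof. intros L (p & l & r & s & H). exists p, l, r, s. intuition lia. Qed.

Lemma chain_hstep_le M gens C C' x n u v : C <= C' ->
  chain (hstep M gens C x) n u v -> chain (hstep M gens C' x) n u v.
Proof.
  intros L. apply (chain_map _ _ (fun w => w)). intros a b. now apply hstep_le.
Qed.

Lemma hstep_suffix M gens C x u v t :
  hstep M gens C x u v -> hstep M gens C x (u ++ t) (v ++ t).
Proof.
  intros (p & l & r & s & -> & -> & H). exists p, l, r, (s ++ t).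
  rewrite <- !app_assoc. auto.
Qed.

Lemma hstep_prefix M gens C x q u v :
  hstep M gens C (act M gens x q) u v -> hstep M gens C x (q ++ u) (q ++ v).
Proof.
  intros (p & l & r & s & -> & -> & H). exists (q ++ p), l, r, s.
  rewrite <- !app_assoc, !(act_app M gens x q). auto.
Qed.

Lemma chain_context M gens C x n q u v t :
  chain (hstep M gens C (act M gens x q)) n u v ->
  chain (hstep M gens C x) n (q ++ u ++ t) (q ++ v ++ t).
Proof.
  apply (chain_map _ _ (fun w => q ++ w ++ t)). intros a b H.
  now apply hstep_prefix, hstep_suffix.
Qed.

Lemma hstep_letters M gens C x u v :
  hstep M gens C x u v -> letters_lt (length gens) u -> letters_lt (length gens) v.
Proof.
  intros (p & l & r & s & -> & -> & _ & _ & _ & Hr & _). rewrite !letters_app. tauto.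
Qed.

(** * Quasi-isometries in terms of paths *)

Definition reach (M : monoid) (gens : list M) (x y : M) (n : nat) : Prop :=
  exists w, letters_lt (length gens) w /\ act M gens x w = y /\ length w <= n.

Lemma reach_le M gens x y n m : n <= m -> reach M gens x y n -> reach M gens x y m.
Proof. intros L (w & H1 & H2 & H3). exists w. repeat split; auto. lia. Qed.

Lemma reach_trans M gens x y z n m :
  reach M gens x y n -> reach M gens y z m -> reach M gens x z (n + m).
Proof.
  intros (u & Hu & Eu & Lu) (v & Hv & Ev & Lv). exists (u ++ v).
  rewrite letters_app, act_app, length_app, Eu. repeat split; auto. lia.
Qed.

Lemma mprod_app M u v : mprod M (u ++ v) = mmul M (mprod M u) (mprod M v).
Proof.
  induction u as [|a u IH]; simpl.
  - symmetry. apply mul1m.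
  - rewrite IH. apply massoc.
Qed.

Lemma dist_le_trans M A x y z r s :
  dist_le M A x y r -> dist_le M A y z s -> dist_le M A x z (r + s).
Proof.
  intros (u & Hu & Eu & Lu) (v & Hv & Ev & Lv). exists (u ++ v). split; [|split].
  - apply Forall_app. auto.
  - rewrite mprod_app, massoc, Eu. exact Ev.
  - rewrite length_app, plus_INR. lra.
Qed.

Lemma dist_le_mul M A x a : generates M A -> exists r, dist_le M A x (mmul M x a) r.
Proof.
  intros HA. destruct (HA a) as (w & Hw & <-). exists (INR (length w)), w.
  repeat split; auto. lra.
Qed.

Lemma spans_of_generates M A : generates M A -> spans M A.
Proof.
  intros HA x. destruct (HA x) as (w & Hw & <-).
  induction Hw as [|a w Ha _ (u & Hu & E)].
  - exists []. split; [constructor | reflexivity].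
  - apply (In_nth _ _ (munit M)) in Ha. destruct Ha as (i & Hi & <-).
    exists (i :: u). split; [constructor; auto|]. simpl. rewrite <- E. reflexivity.
Qed.

(** Spelling each of the finitely many letters of [A] over [gens] changes the generating set at the
    cost of a constant factor. *)
Lemma reach_of_dist M gens A : spans M gens ->
  exists c, forall x y r m, dist_le M A x y r -> (r <= INR m)%R -> reach M gens x y (m * c).
Proof.
  intros Hg.
  assert (H : exists c, forall a, In a A -> forall x, reach M gens x (mmul M x a) c).
  { induction A as [|a A (c & IH)].
    - exists 0. intros ? [].
    - destruct (Hg a) as (w & Hw & <-). exists (length w + c).
      intros a' [<-|Ha'] x.
      + exists w. repeat split; auto. lia.
      + apply (reach_le M gens x _ c); [lia|]. now apply IH. }
  destruct H as [c Hc]. exists c. intros x y r m (w & Hw & <- & L) Lm.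
  apply (reach_le M gens x _ (length w * c)).
  - apply Nat.mul_le_mono_r, INR_le. lra.
  - clear L Lm. revert x. induction Hw as [|a w Ha _ IH]; intros x.
    + exists []. simpl. rewrite act_nil, mulm1. repeat split; constructor.
    + simpl. rewrite massoc. eapply reach_trans; [apply (Hc a Ha) | apply IH].
Qed.

Lemma dist_of_generators (M : monoid) A (gens : list M) : generates M A ->
  exists c, forall x a, In a gens -> dist_le M A x (mmul M x a) c.
Proof.
  intros HA. induction gens as [|a gens (c & IH)].
  - exists 0%R. intros ? ? [].
  - destruct (HA a) as (w & Hw & <-). exists (Rmax (INR (length w)) c).
    intros x a' [<-|Ha'].
    + exists w. repeat split; auto. apply Rmax_l.
    + destruct (IH x a' Ha') as (u & Hu & E & L). exists u. repeat split; auto.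
      eapply Rle_trans; [exact L | apply Rmax_r].
Qed.

Lemma nat_above (r : R) : exists m, (r <= INR m)%R.
Proof. destruct (INR_unbounded r) as [m Hm]. exists m. lra. Qed.

(** The quasi-inverse [g] is chosen from the density condition. Its bounds come from the lower bound
    for [f], applied to paths in [N] that join values of [f]. *)
Lemma quasi_isometry_paths M N A B f gens :
  generates M A -> generates N B -> quasi_isometry M N A B f -> spans M gens ->
  exists (g : N -> M) (K : nat),
    (forall x a, In a gens -> reach N B (f x) (f (mmul M x a)) K) /\
    (forall y b, In b B -> reach M gens (g y) (g (mmul N y b)) K) /\
    (forall y, reach N B y (f (g y)) K /\ reach N B (f (g y)) y K) /\
    reach M gens (g (munit N)) (munit M) K.
Proof.
  intros HA HB (lam & eps & mu & Hlam & Heps & Hmu & Hup & Hlow & Hdense) Hg.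
  destruct (choose _ Hdense) as [g Hd].
  destruct (reach_of_dist M gens A Hg) as [cM HcM].
  destruct (reach_of_dist N B B (spans_of_generates N B HB)) as [cN HcN].
  destruct (dist_of_generators M A gens HA) as [ca Hca].
  destruct (dist_of_generators N B B HB) as [cb Hcb].
  destruct (dist_le_mul N B (munit N) (f (munit M)) HB) as [d1 Hd1]. rewrite mul1m in Hd1.
  destruct (nat_above (lam * ca + eps)) as [m1 H1].
  (* The summands [mu], [cb], [mu] are the legs of the path through [f (g y)], [y], [y b],
     [f (g (y b))]. *)
  destruct (nat_above (lam * (mu + cb + mu + eps))) as [m2 H2].
  destruct (nat_above mu) as [m3 H3].
  destruct (nat_above (lam * (mu + d1 + eps))) as [m4 H4].
  exists g, (m1 * cN + m2 * cM + m3 * cN + m4 * cM). split; [|split; [|split]].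
  - intros x a Ha. apply (reach_le N B _ _ (m1 * cN)); [lia|].
    eapply HcN; [|exact H1]. apply Hup, Hca, Ha.
  - intros y b Hb. apply (reach_le M gens _ _ (m2 * cM)); [lia|].
    eapply HcM; [|exact H2]. apply Hlow.
    eapply dist_le_trans; [eapply dist_le_trans|]; [apply Hd | apply Hcb, Hb | apply Hd].
  - intros y. split; apply (reach_le N B _ _ (m3 * cN)); try lia;
      (eapply HcN; [apply Hd | exact H3]).
  - apply (reach_le M gens _ _ (m4 * cM)); [lia|].
    eapply HcM; [|exact H4]. apply Hlow. eapply dist_le_trans; [apply Hd | exact Hd1].
Qed.

(** * Images of paths and homotopies under a map of vertices *)

Fixpoint lift (M : monoid) (gens : list M) (phi : M -> nat -> list nat) (x : M) (w : list nat)
    : list nat :=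
  match w with
  | [] => []
  | i :: w' => phi x i ++ lift M gens phi (mmul M x (nth i gens (munit M))) w'
  end.

Lemma lift_app M gens phi x u v :
  lift M gens phi x (u ++ v) = lift M gens phi x u ++ lift M gens phi (act M gens x u) v.
Proof.
  revert x. induction u as [|i u IH]; intros x; simpl.
  - now rewrite act_nil.
  - now rewrite IH, act_cons, app_assoc.
Qed.

Definition lifts (M N : monoid) (a : list M) (b : list N) (f : M -> N) (K : nat)
    (phi : M -> nat -> list nat) : Prop :=
  forall x i, letters_lt (length b) (phi x i) /\
    act N b (f x) (phi x i) = f (mmul M x (nth i a (munit M))) /\ length (phi x i) <= K.

Lemma lifts_exist (M N : monoid) a b (f : M -> N) K :
  (forall x c, In c a -> reach N b (f x) (f (mmul M x c)) K) ->
  exists phi, lifts M N a b f K phi.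
Proof.
  intros H.
  destruct (choose (fun (xi : M * nat) w => letters_lt (length b) w /\
    act N b (f (fst xi)) w = f (mmul M (fst xi) (nth (snd xi) a (munit M))) /\ length w <= K))
    as [phi Hphi].
  - intros [x i]. simpl. destruct (nth_in_or_default i a (munit M)) as [Hi|Hi].
    + apply H, Hi.
    + exists []. rewrite Hi, act_nil, mulm1. repeat split; [constructor | simpl; lia].
  - exists (fun x i => phi (x, i)). intros x i. apply (Hphi (x, i)).
Qed.

Lemma lift_letters (M N : monoid) a b (f : M -> N) K phi x w :
  lifts M N a b f K phi -> letters_lt (length b) (lift M a phi x w).
Proof.
  intros Hphi. revert x. induction w as [|i w IH]; intros x; simpl; [constructor|].
  apply letters_app. split; [apply Hphi | apply IH].
Qed.

Lemma lift_length (M N : monoid) a b (f : M -> N) K phi x w :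
  lifts M N a b f K phi -> length (lift M a phi x w) <= length w * K.
Proof.
  intros Hphi. revert x. induction w as [|i w IH]; intros x; simpl; [lia|].
  rewrite length_app. specialize (IH (mmul M x (nth i a (munit M)))).
  destruct (Hphi x i) as (_ & _ & L). lia.
Qed.

Lemma act_lift (M N : monoid) a b (f : M -> N) K phi x w :
  lifts M N a b f K phi -> act N b (f x) (lift M a phi x w) = f (act M a x w).
Proof.
  intros Hphi. revert x. induction w as [|i w IH]; intros x; simpl; [now rewrite !act_nil|].
  rewrite act_app, act_cons. destruct (Hphi x i) as (_ & -> & _). apply IH.
Qed.

(** The images of [l] and [r] have common ends because those of [l] and [r] are common; for the same
    reason the suffix [s] has one image in both paths. *)
Lemma hstep_lift (M N : monoid) a b (f : M -> N) K phi C x u v :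
  lifts M N a b f K phi -> hstep M a C x u v ->
  hstep N b (C * K) (f x) (lift M a phi x u) (lift M a phi x v).
Proof.
  intros Hphi (p & l & r & s & -> & -> & Ll & Lr & Hl & Hr & E).
  exists (lift M a phi x p), (lift M a phi (act M a x p) l), (lift M a phi (act M a x p) r),
    (lift M a phi (act M a x (p ++ l)) s).
  rewrite <- !lift_app, !(act_lift M N a b f K phi) by exact Hphi.
  rewrite !lift_app, <- !act_app, E.
  pose proof (lift_length M N a b f K phi (act M a x p) l Hphi).
  pose proof (lift_length M N a b f K phi (act M a x p) r Hphi).
  repeat split; eauto using lift_letters; nia.
Qed.

(** A loop made of [beta] and [alpha] is inserted at the end of the path, and its first half is then
    carried back to the start, across one square for each letter. *)
Lemma ladder (M N : monoid) a b (f : M -> N) (g : N -> M) K phi psi alpha beta :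
  lifts M N a b f K phi -> lifts N M b a g K psi ->
  (forall y, letters_lt (length b) (beta y) /\ act N b y (beta y) = f (g y) /\
             length (beta y) <= K) ->
  (forall y, letters_lt (length b) (alpha y) /\ act N b (f (g y)) (alpha y) = y /\
             length (alpha y) <= K) ->
  forall w y, letters_lt (length b) w ->
    chain (hstep N b (1 + 2 * K + K * K) y) (S (length w)) w
      (beta y ++ lift M a phi (g y) (lift N b psi y w) ++ alpha (act N b y w)).
Proof.
  intros Hphi Hpsi Hbeta Halpha w. induction w as [|i w IH]; intros y Hw.
  - simpl. apply chain_one, hstep_base.
    + simpl. lia.
    + rewrite length_app, act_nil. pose proof (Hbeta y). pose proof (Halpha y). lia.
    + constructor.
    + apply letters_app. split; [apply Hbeta | apply Halpha].
    + rewrite act_app, !act_nil. destruct (Hbeta y) as (_ & -> & _).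
      symmetry. apply Halpha.
  - apply Forall_inv in Hw as Hi. apply Forall_inv_tail in Hw.
    set (y' := mmul N y (nth i b (munit N))).
    assert (Ey : act N b y [i] = y') by now rewrite act_cons, act_nil.
    apply (chain_le _ (S (length w) + 1)); [simpl; lia|].
    eapply chain_trans.
    + specialize (IH y' Hw). rewrite <- Ey in IH.
      apply (chain_context N b _ y _ [i] _ _ []) in IH. rewrite !app_nil_r in IH.
      change ([i] ++ w) with (i :: w) in IH. exact IH.
    (* The square: going along [i] and then down the rung at [y'] is exchanged for going down the
       rung at [y] and then along the round trip of the edge. *)
    + rewrite Ey, act_cons. fold y'. simpl lift. fold y'.
      rewrite lift_app. destruct (Hpsi y i) as (Lp & Ep & Np). fold y' in Ep. rewrite Ep.
      rewrite <- !app_assoc, (app_assoc (beta y)), (app_assoc [i]).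
      apply chain_one, hstep_suffix, hstep_base.
      * simpl. pose proof (Hbeta y'). lia.
      * rewrite length_app. pose proof (Hbeta y).
        pose proof (lift_length M N a b f K phi (g y) (psi y i) Hphi). nia.
      * constructor; [exact Hi | apply Hbeta].
      * apply letters_app. split; [apply Hbeta|]. eapply lift_letters; eauto.
      * rewrite !act_app, Ey. destruct (Hbeta y) as (_ & -> & _).
        rewrite (act_lift M N a b f K phi) by exact Hphi. rewrite Ep. apply Hbeta.
Qed.

(** * Bounded homotopies and quasi-isometry *)

Definition homotopy_bound (M : monoid) (gens : list M) (C : nat) (T : nat -> nat) : Prop :=
  forall n u v, letters_lt (length gens) u -> letters_lt (length gens) v ->
    length u <= n -> length v <= n -> pres_eval M gens u = pres_eval M gens v ->
    chain (hstep M gens C (munit M)) (T n) u v.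

Lemma homotopy_bound_transfer M N A B f gens C T :
  generates M A -> generates N B -> quasi_isometry M N A B f -> spans M gens ->
  homotopy_bound M gens C T ->
  exists C' c K, homotopy_bound N B C' (fun n => T (c + n * K) + 2 * n + 4).
Proof.
  intros HA HB Hqi Hg HT.
  destruct (quasi_isometry_paths M N A B f gens HA HB Hqi Hg)
    as (g & K & Hf & Hg' & Hfg & (s & Hs & Es & _)).
  destruct (lifts_exist M N gens B f K Hf) as [phi Hphi].
  destruct (lifts_exist N M B gens g K Hg') as [psi Hpsi].
  destruct (choose _ (fun y => proj1 (Hfg y))) as [beta Hbeta].
  destruct (choose _ (fun y => proj2 (Hfg y))) as [alpha Halpha].
  destruct (Hg (g (munit N))) as (q & Hq & Eq).
  set (x := g (munit N)) in *.
  set (C1 := C + length s + length q).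
  set (C' := 1 + 2 * K + K * K + C1 * K).
  exists C', (length q), K. intros n u v Hu Hv Lu Lv E.
  assert (Lad : forall w, letters_lt (length B) w -> length w <= n ->
    chain (hstep N B C' (munit N)) (S n) w
      (beta (munit N) ++ lift M gens phi x (lift N B psi (munit N) w)
         ++ alpha (pres_eval N B w))).
  { intros w Hw Lw. apply (chain_hstep_le N B (1 + 2 * K + K * K)); [unfold C'; lia|].
    apply (chain_le _ (S (length w))); [lia|]. rewrite <- act_one.
    now apply (ladder M N gens B f g K phi psi alpha beta). }
  set (U := lift N B psi (munit N) u). set (V := lift N B psi (munit N) v).
  assert (EUV : act M gens x U = act M gens x V).
  { unfold x, U, V. rewrite !(act_lift N M B gens g K psi), !act_one by exact Hpsi. congruence. }
  (* The path [q] from 1 to [x] has a return path [s], so that paths from [x] can be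
     pushed to paths from 1 at the cost of the loop [s ++ q]. *)
  assert (Loop : forall W, hstep M gens C1 x W (s ++ q ++ W)).
  { intros W. rewrite app_assoc. apply (hstep_suffix M gens C1 x [] (s ++ q) W).
    apply hstep_base.
    - simpl. lia.
    - rewrite length_app. unfold C1. lia.
    - constructor.
    - now apply letters_app.
    - rewrite act_app, Es, act_one, Eq. apply act_nil. }
  assert (HUV : chain (hstep M gens C1 x) (1 + T (length q + n * K) + 1) U V).
  { eapply chain_trans; [eapply chain_trans|].
    - apply chain_one, Loop.
    - apply (chain_hstep_le M gens C); [unfold C1; lia|].
      assert (H : chain (hstep M gens C (munit M)) (T (length q + n * K)) (q ++ U) (q ++ V)).
      { apply HT.
        - apply letters_app. split; auto. eapply lift_letters; eauto.
        - apply letters_app. split; auto. eapply lift_letters; eauto.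
        - rewrite length_app.
          pose proof (lift_length N M B gens g K psi (munit N) u Hpsi). fold U in H. nia.
        - rewrite length_app.
          pose proof (lift_length N M B gens g K psi (munit N) v Hpsi). fold V in H. nia.
        - rewrite <- !(act_one M gens), !act_app, act_one, Eq. exact EUV. }
      rewrite <- Es in H. apply (chain_context M gens C x _ s _ _ []) in H.
      rewrite !app_nil_r in H. exact H.
    - apply chain_one, hstep_sym, Loop. }
  apply (chain_map _ (hstep N B C' (f x)) (lift M gens phi x)) in HUV.
  2:{ intros l r H. apply (hstep_le N B (C1 * K)); [unfold C'; lia|].
      now apply hstep_lift. }
  destruct (Hbeta (munit N)) as (_ & Eb & _). fold x in Eb. rewrite <- Eb in HUV.
  apply (chain_context N B C' (munit N) _ _ _ _ (alpha (pres_eval N B u))) in HUV.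
  (* Two ladders of at most [S n] moves each, and one move each for inserting and removing the
     loop. *)
  replace (T (length q + n * K) + 2 * n + 4)
    with (S n + (1 + T (length q + n * K) + 1) + S n) by lia.
  eapply chain_trans; [eapply chain_trans|].
  - apply Lad; auto.
  - exact HUV.
  - apply chain_sym; [intros; now apply hstep_sym|]. rewrite E. now apply Lad.
Qed.

(** * Finite presentations from bounded homotopies *)

(** One generator is kept for each listed ideal that is principal; elements generating the same
    principal left ideal are left multiples of each other. *)
Lemma left_class_representatives N : finitely_many N (left_ideal N) ->
  exists Y : list N, forall x, exists y, In y Y /\
    (exists m, x = mmul N m y) /\ (exists m, y = mmul N m x).
Proof.
  intros [L HL].
  assert (H : exists Y : list N, forall x, (exists J, In J L /\
             forall z, (exists m, z = mmul N m x) <-> J z) ->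
           exists y, In y Y /\ (exists m, x = mmul N m y) /\ (exists m, y = mmul N m x)).
  { clear HL. induction L as [|J L (Y & IH)].
    - exists []. intros x (J & [] & _).
    - assert (R : forall x, exists m, x = mmul N m x)
        by (intros x; exists (munit N); now rewrite mul1m).
      destruct (classic (exists y, forall z, (exists m, z = mmul N m y) <-> J z))
        as [[y Hy]|Hn].
      + exists (y :: Y). intros x (J' & [<-|HJ] & Hx).
        * exists y. split; [now left|]. split; [apply Hy, Hx, R | apply Hx, Hy, R].
        * destruct (IH x) as (y' & H1 & H2); [eauto|]. exists y'. split; [now right | auto].
      + exists Y. intros x (J' & [<-|HJ] & Hx); [exfalso; eauto|]. apply IH. eauto. }
  destruct H as [Y HY]. exists Y. intros x. apply HY.
  apply (HL (fun z => exists m, z = mmul N m x)).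
  intros m z [m' ->]. exists (mmul N m m'). apply massoc.
Qed.

Fixpoint words (k n : nat) : list (list nat) :=
  match n with
  | 0 => [[]]
  | S n' => [] :: flat_map (fun w => map (fun i => i :: w) (seq 0 k)) (words k n')
  end.

Lemma in_words k n w : In w (words k n) <-> letters_lt k w /\ length w <= n.
Proof.
  revert w. induction n as [|n IH]; intros w; simpl.
  - split.
    + intros [<-|[]]. split; [constructor | auto].
    + intros [_ L]. destruct w; [auto | simpl in L; lia].
  - rewrite in_flat_map. split.
    + intros [<-|(v & Hv & Hw)]; [split; [constructor | simpl; lia]|].
      apply in_map_iff in Hw. destruct Hw as (i & <- & Hi). apply in_seq in Hi.
      apply IH in Hv. destruct Hv as [Hv L]. simpl. split; [constructor; [lia | auto] | lia].
    + intros [Hw L]. destruct w as [|i w]; [auto|]. right. exists w.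
      apply Forall_inv in Hw as Hi. apply Forall_inv_tail in Hw. simpl in L. split.
      * apply IH. split; [auto | lia].
      * apply (in_map (fun j => j :: w)), in_seq. lia.
Qed.

(** Membership is decided classically: the list of true relations only has to exist. *)
Lemma finite_subset {X : Type} (P : X -> Prop) (L : list X) :
  exists L', forall x, In x L' <-> In x L /\ P x.
Proof.
  exists (filter (fun x => if excluded_middle_informative (P x) then true else false) L).
  intros x. rewrite filter_In. destruct (excluded_middle_informative (P x)); intuition congruence.
Qed.

Lemma presentation_of_homotopy_bound (N : monoid) (b : list N) C T :
  spans N b -> finitely_many N (left_ideal N) -> homotopy_bound N b C T ->
  exists Rel, is_finite_presentation N b Rel /\
    dehn_bound (length b) Rel (fun n => T n * (2 * (n + T n * C) + 3)).
Proof.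
  intros Hb HL HT. set (k := length b). set (ev := pres_eval N b).
  destruct (left_class_representatives N HL) as [Y HY].
  assert (HW : exists W, (forall w, In w W -> letters_lt k w) /\
                 forall y, In y Y -> exists w, In w W /\ ev w = y).
  { clear HY. induction Y as [|y Y (W & H1 & H2)].
    - exists []. split; intros ? [].
    - destruct (Hb y) as (w & Hw & E). exists (w :: W). split.
      + intros w' [<-|H]; auto.
      + intros y' [<-|H]; [exists w; split; [now left | auto]|].
        destruct (H2 y' H) as (w' & ? & ?). exists w'. split; [now right | auto]. }
  destruct HW as (W & HWk & HWY).
  (* The word [snd qy] represents the L-class of [w], and [fst qy] is a left factor that recovers
     the value of [w] from it. *)
  assert (HZ : forall w, exists qy : list nat * list nat, In (snd qy) W /\
    letters_lt k (fst qy) /\ ev w = ev (fst qy ++ snd qy) /\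
    exists m, ev (snd qy) = mmul N m (ev w)).
  { intros w. destruct (HY (ev w)) as (y & Hy & [m Em] & Em').
    destruct (HWY y Hy) as (wy & Hwy & <-). destruct (Hb m) as (q & Hq & <-).
    exists (q, wy). simpl. repeat split; auto. unfold ev at 2. now rewrite pres_eval_app. }
  destruct (choose _ HZ) as [Z HZ'].
  set (nf w := (w, fst (Z w) ++ snd (Z w))).
  destruct (finite_subset (fun lr => ev (fst lr) = ev (snd lr))
    (flat_map (fun y => map (fun lr => (y ++ fst lr, y ++ snd lr))
       (list_prod (words k C) (words k C))) W)) as [R2 HR2].
  set (R1 := map nf (flat_map (fun y => map (fun i => y ++ [i]) (seq 0 k)) W)).
  (* [nf []] starts the rewriting by creating the representative of the class of 1, [R1] lets it
     absorb one letter, and [R2] applies moves to it. *)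
  set (Rel := nf [] :: R1 ++ R2).
  assert (Hnf : forall w, letters_lt k w ->
     letters_lt k (fst (nf w)) /\ letters_lt k (snd (nf w)) /\ ev (fst (nf w)) = ev (snd (nf w))).
  { intros w Hw. destruct (HZ' w) as (H1 & H2 & H3 & _). simpl. rewrite letters_app.
    repeat split; auto. }
  assert (HRel : forall l r, In (l, r) Rel -> letters_lt k l /\ letters_lt k r /\ ev l = ev r).
  { intros l r [E|H]; [|apply in_app_iff in H; destruct H as [H|H]].
    - rewrite <- (f_equal fst E : _ = l), <- (f_equal snd E : _ = r). apply Hnf. constructor.
    - apply in_map_iff in H. destruct H as (w & E & H).
      rewrite <- (f_equal fst E : _ = l), <- (f_equal snd E : _ = r). apply Hnf.
      apply in_flat_map in H. destruct H as (y & Hy & H). apply in_map_iff in H.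
      destruct H as (i & <- & Hi). apply in_seq in Hi. apply letters_app.
      split; [now apply HWk | constructor; [lia | constructor]].
    - apply HR2 in H. destruct H as [H E]. simpl in E. split; [|split; [|exact E]];
      apply in_flat_map in H; destruct H as (y & Hy & H); apply in_map_iff in H;
      destruct H as ([l' r'] & E' & H); apply in_prod_iff in H; simpl in E';
      injection E' as <- <-; rewrite !in_words in H; apply letters_app; split; auto; tauto. }
  assert (Hover : rel_over k Rel).
  { apply Forall_forall. intros [l r] H. apply HRel in H. simpl. tauto. }
  assert (Hsound : forall u v, rcong Rel u v -> ev u = ev v).
  { induction 1 as [u|u v _ IH|u v w _ IH1 _ IH2|p l r s H]; try congruence.
    apply HRel in H. destruct H as (_ & _ & E).
    unfold ev in *. rewrite !pres_eval_app. congruence. }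
  (* Letters are absorbed from left to right, one relation each after the initial one. That [y] is a
     left multiple of [p] is kept so that equations valid after [p] remain valid after [y]. *)
  assert (Hprefix : forall p, letters_lt k p -> exists q y, In y W /\
     chain (rstep Rel) (S (length p)) p (q ++ y) /\ exists m, ev y = mmul N m (ev p)).
  { intros p. induction p as [|i p IH] using rev_ind; intros Hp.
    - exists (fst (Z [])), (snd (Z [])). destruct (HZ' []) as (H1 & _ & _ & H4).
      split; auto. split; auto. apply chain_one. exists [], [], (snd (nf [])), [].
      rewrite !app_nil_r. split; [|auto]. apply in_rules. left. now left.
    - apply letters_app in Hp. destruct Hp as [Hp Hi].
      destruct (IH Hp) as (q & y & Hy & Hc & [m Em]).
      destruct (HZ' (y ++ [i])) as (H1 & _ & _ & [m' Em']).
      exists (q ++ fst (Z (y ++ [i]))), (snd (Z (y ++ [i]))). split; auto. split.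
      + rewrite length_app, Nat.add_1_r, <- (Nat.add_1_r (S (length p))).
        apply (chain_trans _ _ _ _ (q ++ (y ++ [i]))).
        * rewrite app_assoc.
          apply (chain_map (rstep Rel) _ (fun w => w ++ [i])); [|exact Hc].
          intros u v. apply (rstep_context Rel [] [i]).
        * apply chain_one. exists q, (y ++ [i]), (snd (nf (y ++ [i]))), [].
          rewrite !app_nil_r, <- app_assoc. split; auto. apply in_rules. left. right.
          apply in_app_iff. left. apply (in_map nf). apply in_flat_map. exists y.
          split; auto. apply in_map_iff. exists i. split; auto. apply in_seq.
          apply Forall_inv in Hi. lia.
      + exists (mmul N m' m). rewrite Em'. unfold ev in *. rewrite !pres_eval_app, Em.
        now rewrite !massoc. }
  assert (Hstep : forall u v, letters_lt k u -> hstep N b C (munit N) u v ->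
     chain (rstep Rel) (2 * length u + 3) u v).
  { intros u v Hu (p & l & r & s & -> & -> & Ll & Lr & Hl & Hr & E).
    apply letters_app in Hu. destruct (Hprefix p) as (q & y & Hy & Hc & [m Em]); [tauto|].
    rewrite !act_one in E.
    assert (Ey : ev (y ++ l) = ev (y ++ r)).
    { unfold ev in *. rewrite !pres_eval_app in *. rewrite Em, <- !massoc. congruence. }
    assert (Hs : forall t, chain (rstep Rel) (S (length p)) (p ++ t ++ s) (q ++ y ++ t ++ s)).
    { intros t. rewrite (app_assoc q).
      apply (chain_map (rstep Rel) _ (fun w => w ++ t ++ s)); [|exact Hc].
      intros u v. apply (rstep_context Rel [] (t ++ s)). }
    (* Bring the prefix to the form [q ++ y], apply one relation of [R2], and undo the first
       part. *)
    apply (chain_le _ (S (length p) + 1 + S (length p))); [rewrite length_app; lia|].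
    eapply chain_trans; [eapply chain_trans|].
    - apply Hs.
    - apply chain_one. exists q, (y ++ l), (y ++ r), s. rewrite <- !app_assoc.
      split; [|split; reflexivity]. apply in_rules. left. right. apply in_app_iff. right.
      apply HR2. split; [|exact Ey]. apply in_flat_map. exists y. split; auto.
      apply in_map_iff. exists (l, r). split; auto. apply in_prod_iff.
      rewrite !in_words. auto.
    - apply chain_sym; [intros; now apply rstep_sym | apply Hs]. }
  assert (Hchain : forall t u v, letters_lt k u -> chain (hstep N b C (munit N)) t u v ->
     chain (rstep Rel) (t * (2 * (length u + t * C) + 3)) u v).
  { intros t u v Hu H. induction H as [t u|t u u' v Hs H IH]; [constructor|].
    eapply chain_le; [|eapply chain_trans; [apply Hstep; eauto | apply IH]].
    - assert (length u' <= length u + C).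
      { destruct Hs as (p & l & r & s & -> & -> & _ & Lr & _). rewrite !length_app. lia. }
      nia.
    - eapply hstep_letters; eauto. }
  assert (Hdehn : forall n u v, letters_lt k u -> letters_lt k v -> length u <= n ->
     length v <= n -> ev u = ev v ->
     chain (rstep Rel) (T n * (2 * (n + T n * C) + 3)) u v).
  { intros n u v Hu Hv Lu Lv E. specialize (HT n u v Hu Hv Lu Lv E).
    apply Hchain in HT; auto. eapply chain_le; [|exact HT]. apply Nat.mul_le_mono_l. lia. }
  exists Rel. split; [split; [|split]|].
  - exact Hover.
  - exact Hb.
  - intros u v Hu Hv. split; [|apply Hsound]. intros E. apply rcong_chain.
    eexists. apply (Hdehn (length u + length v)); auto; lia.
  - intros n u v Hu Hv Lu Lv H. apply Hdehn; auto.
Qed.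

(** A relation holds at every vertex, so each rule application is a move, with [C] the bound on the
    sides of the rules. *)
Lemma homotopy_bound_of_dehn_bound M gens Rel T :
  is_finite_presentation M gens Rel -> dehn_bound (length gens) Rel T ->
  exists C, homotopy_bound M gens C T.
Proof.
  intros (Hover & Hspan & Heq) HT.
  destruct (rules_length_bound (rules Rel)) as [C HC]. exists C.
  intros n u v Hu Hv Lu Lv E. apply Heq in E; auto. specialize (HT n u v Hu Hv Lu Lv E).
  revert HT. apply (chain_map _ _ (fun w => w)).
  intros u' v' (p & l & r & s & H & -> & ->). exists p, l, r, s.
  destruct (HC _ _ H). destruct (rules_over _ _ _ _ Hover H). repeat split; auto.
  rewrite !act_one, !pres_eval_app. f_equal. apply Heq; auto.
  apply rcong_chain. exists 1. apply chain_one. exists [], l, r, []. now rewrite !app_nil_r.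
Qed.

Theorem theorem5p8 (M N : monoid) :
  finitely_generated M -> finitely_generated N ->
  finitely_many M (left_ideal M) -> finitely_many M (right_ideal M) ->
  finitely_many N (left_ideal N) -> finitely_many N (right_ideal N) ->
  quasi_isometric M N ->
  fp_solvable_wp M -> fp_solvable_wp N.
Proof.
  intros _ _ _ _ HL _ (A & B & f & HA & HB & Hqi) (gens & Rel & Hpres & Hwp).
  destruct (dehn_bound_of_solvable _ _ (proj1 Hpres) Hwp) as (T & HT & HTd).
  destruct (homotopy_bound_of_dehn_bound M gens Rel T Hpres HTd) as [C HC].
  destruct (homotopy_bound_transfer M N A B f gens C T HA HB Hqi (proj1 (proj2 Hpres)) HC)
    as (C' & c & K & HC').
  destruct (presentation_of_homotopy_bound N B C' _ (spans_of_generates N B HB) HL HC')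
    as (Rel' & Hpres' & HD).
  exists B, Rel'. split; [exact Hpres'|].
  refine (solvable_of_dehn_bound _ _ _ (proj1 Hpres') _ HD).
  (* The final bound is a polynomial in [n] and this one value of [T]. *)
  assert (H : computable 1 (fun v => T (c + nth 0 v 0 * K)))
    by (apply (computable_app1 T HT); computable_arith).
  computable_arith.
Qed.
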